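(* Let $\Sigma_i=(X_i,U_i,F_i)$, $i\in\{1,2\}$, be two systems. Let $T_1\subseteq Q_1\subseteq X_1$ and $T_2\subseteq Q_2\subseteq X_2$ be nonempty sets. Suppose that $R\subseteq X_1\times X_2$ is a feedback refinement relation from $\Sigma_1$ to $\Sigma_2$, that $Q_1=R^{-1}(Q_2)$, $T_1=R^{-1}(T_2)$, $\#R(x_1)=1$ for all $x_1\in X_1$, and $R^{-1}(x_2)\neq\varnothing$ for all $x_2\in Q_2$. Then $$h_1(Q_1,T_1)\le h_2(Q_2,T_2),$$ where $h_i(Q_i,T_i)$ denotes the $(Q_i,T_i)$-reachability entropy of $\Sigma_i$.
   Context: Notation. $[a;b]$ denotes the set of integers $j$ with $a\le j\le b$. $B^A$ is the set of functions $A\to B$. $f:A\rightrightarrows B$ denotes a set-valued map, $f|_M$ restriction to $M$, and $\#A$ the cardinality of $A$. A cover of a set $B$ is a set $\mathcal{A}$ of subsets of $B$ with $B=\bigcup_{A\in\mathcal{A}}A$. For a relation $R\subseteq X_1\times X_2$, $R(x_1)=\{x_2\mid(x_1,x_2)\in R\}$, $R(D)=\bigcup_{d\in D}R(d)$ for $D\subseteq X_1$, and $R^{-1}$ is the inverse relation; $R$ is strict if $R(x_1)\neq\varnothing$ for every $x_1\in X_1$. System. A system is a triple $\Sigma=(X,U,F)$, where $X,U$ are nonempty sets and $F:X\times U\rightrightarrows X$ is the transition function. For $A\subseteq X$, $F(A,u)=\bigcup_{x\in A}F(x,u)$. Feedback refinement relation. A strict relation $R\subseteq X_1\times X_2$ is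 a feedback refinement relation from $\Sigma_1$ to $\Sigma_2$ if there exists a map $r:U_2\to U_1$ such that $R(F_1(x_1,r(u)))\subseteq F_2(x_2,u)$ for all $(x_1,x_2)\in R$ and $u\in U_2$. $(Q,T)$-reachability. For a system $\Sigma$ and $T\subseteq Q\subseteq X$, $(Q,T)$-reachability is said to be satisfiable for $\Sigma$ if every state in $Q$ can be taken to the set $T$ in finite time using a finite set of control inputs, while never leaving $Q$. Reach-spanning set. Let $\mathcal{A}$ be a finite cover of $Q\setminus T$ and $G:\bigcup_{t\in\mathbb{Z}_{\ge0}}\mathcal{A}^{[0;t]}\to U$ a map. Consider a set $\mathcal{R}=\{\alpha_1,\dots,\alpha_N\}$, $N\in\mathbb{N}$, where $\alpha_i$ is a sequence of length $\tau_i\in\mathbb{N}$ (indexed by $[0;\tau_i-1]$) in the power set of $Q$. $\mathcal{R}$ is called $(Q,T)$-reach-spanning in $(\mathcal{A},G)$ if: (1) $Q=\bigcup_{i\in[1;N]}\alpha_i(0)$; (2) only the last element of every sequence is equal to $T$, while all other elements of the sequence do not intersect $T$, i.e. $\alpha_i|_{[0;\tau_i-2]}\in\mathcal{A}^{[0;\tau_i-2]}$ and $\alpha_i(\tau_i-1)=T$; (3) for every $\alpha_i\in\mathcal{R}$ and $t\in[0;\tau_i-2]$, $F(\alpha_i(t),G(\alpha_i|_{[0;t]}))\subseteq\bigcup_{A\in P_{\mathcal{R}}(\alpha_i|_{[0;t]})}A$, where $P_{\mathcal{R}}(\alpha_i|_{[0;t]}):=\{A\in\mathcal{A}\cup\{T\}\mid\exists\,\alpha_k\in\mathcal{R}:\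 \alpha_k|_{[0;t]}=\alpha_i|_{[0;t]}\ \wedge\ A=\alpha_k(t+1)\}$. Trivial case (additional convention). For $\mathcal{A}_1=\{Q\setminus T\}$, a fixed $u_1\in U$, and the constant map $G_1(\alpha):=u_1$, the set $\mathcal{R}=\{T\}$ (the single length-one sequence $T$) is also called $(Q,T)$-reach-spanning in $(\mathcal{A}_1,G_1)$ if for every $x\in Q\setminus T$ and every trajectory $\xi_x$ (i.e. every sequence of states with $\xi_x(0)=x$ and $\xi_x(t)\in F(\xi_x(t-1),u_1)$ for all $t\ge1$) there exists $n_{\xi_x}\in\mathbb{N}$ such that $\xi_x(n_{\xi_x})\in T$ and $\xi_x(t)\in Q\setminus T$ for $t\in[0;n_{\xi_x}-1]$. Entropy. Let $\hat P_{\mathcal{R}}(\alpha|_{[0;t]}):=P_{\mathcal{R}}(\alpha|_{[0;t]})\setminus\{T\}$ and $\mathcal{R}_0:=\{\alpha(0)\mid\alpha\in\mathcal{R},\ \alpha(0)\neq T\}$. For $\alpha\in\mathcal{R}$ of length $\tau$, let $$\mathcal{B}(\alpha):=\frac{1}{\tau-1}\Big[\sum_{t=0}^{\tau-3}\log_2\#\hat P_{\mathcal{R}}(\alpha|_{[0;t]})+\log_2\#\mathcal{R}_0\Big]\ \text{ if }\tau>1,\qquad \mathcal{B}(\alpha):=0\ \text{ if }\tau=1.$$ Let $\mathcal{N}(\mathcal{R}):=\max_{\alpha\in\mathcal{R}}\mathcal{B}(\alpha)$ and $$r(\mathcal{A},G,Q,T):=\min\{\mathcal{N}(\mathcal{R})\mid\mathcal{R}\text{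 is a }(Q,T)\text{-reach-spanning set in }(\mathcal{A},G)\}.$$ The $(Q,T)$-reachability entropy is $h(Q,T):=\inf_{(\mathcal{A},G)}r(\mathcal{A},G,Q,T)$, over all pairs $(\mathcal{A},G)$ consisting of a finite cover $\mathcal{A}$ of $Q\setminus T$ and a map $G:\bigcup_{t\in\mathbb{Z}_{\ge0}}\mathcal{A}^{[0;t]}\to U$. If $(Q,T)$-reachability is not satisfiable for $\Sigma$, $h(Q,T)$ is defined to be infinite.
   Formalization: Satisfiability of (Q,T)-reachability is read as: under some strategy with finitely many inputs no run leaves Q before T and every infinite trajectory reaches T; runs that block because F is empty carry no obligation, as the claim fails if blocking counts as failure (F not assumed strict). *)

(* Defs.v *)
From HB Require Import structures.
From mathcomp Require Import all_boot all_order all_algebra.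
From mathcomp Require Import finmap.
From mathcomp Require Import all_classical all_reals.
From mathcomp Require Import ereal exp.

Set Implicit Arguments.
Unset Strict Implicit.
Unset Printing Implicit Defensive.

Import Order.TTheory GRing.Theory Num.Theory.

Local Open Scope classical_set_scope.
Local Open Scope ring_scope.

(* The sets of values of [trans] may be empty: strictness is not assumed. *)
Record system := System {
  state : Type;
  input : Type;
  trans : state -> input -> set state;
  state_inhabited : inhabited state;
  input_inhabited : inhabited input }.

Arguments trans : clear implicits.

Section Relations.
Context {X1 X2 : Type}.
Implicit Type R : set (X1 * X2).

Definition relimg R (D : set X1) : set X2 := \bigcup_(x1 in D) xsection R x1.

Definition relpreimg R (D : set X2) : set X1 := \bigcup_(x2 in D) ysection R x2.

Definition strict_rel R := forall x1, xsection R x1 !=set0.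

End Relations.

Definition feedback_refinement_relation (S1 S2 : system)
    (R : set (state S1 * state S2)) : Prop :=
  strict_rel R /\
  exists r : input S2 -> input S1,
    forall x1 x2 (u : input S2), R (x1, x2) ->
      relimg R (trans S1 x1 (r u)) `<=` trans S2 x2 u.

Section ReachabilityEntropy.
Context {S : system}.
Let X := state S.
Let U := input S.

Implicit Types (Q T : set X) (A : set (set X)) (G : seq (set X) -> U).
Implicit Types (Rs : set (seq (set X))) (a b : seq (set X)).

Definition transs (B : set X) (u : U) : set X := \bigcup_(x in B) trans S x u.

(* A strategy [k] chooses the input at time t from the states visited on [0;t];
   all the inputs it uses lie in one finite set [V]. Until [T] is reached, no
   finite run under [k] leaves [Q], and every trajectory, that is every infinite
   run, reaches [T]. A run ending in [Q] in a state without successors is not a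
   trajectory. *)
Definition reachability_satisfiable Q T : Prop :=
  exists V : set U, finite_set V /\
  exists2 k : seq X -> U, (forall s, V (k s)) &
    let step (xi : nat -> X) t :=
      trans S (xi t) (k (mkseq xi t.+1)) (xi t.+1) in
    forall xi : nat -> X, Q (xi 0%N) ->
      (forall n, (forall t, (t < n)%N -> step xi t /\ ~ T (xi t)) ->
         Q (xi n)) /\
      ((forall t, step xi t) -> exists n, T (xi n)).

Definition finite_cover A (B : set X) : Prop :=
  finite_set A /\ \bigcup_(C in A) C = B.

(* [b] stands for a restriction alpha|_[0;t], so that t + 1 = size b. *)
Definition succs A T Rs b : set (set X) :=
  [set C | (A C \/ C = T) /\
    exists2 a, Rs a &
      [/\ (size b < size a)%N, take (size b) a = b & C = nth set0 a (size b)]].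

(* Sequences of length tau indexed by [0;tau-1] are lists, and alpha|_[0;t] is
   [take t.+1 alpha]. The map [G], whose domain is the set of nonempty sequences
   in [A], is represented by an arbitrary extension to all lists: it is only
   ever evaluated on that domain. *)
Definition regular_reach_spanning Q T A G Rs : Prop :=
  [/\ finite_set Rs, Rs !=set0,
      (forall a, Rs a ->
         (0 < size a)%N /\
         forall t, (t < size a)%N -> nth set0 a t `<=` Q) &
  [/\ Q = \bigcup_(a in Rs) nth set0 a 0%N,
      (forall a, Rs a ->
         (forall t, (t.+1 < size a)%N -> A (nth set0 a t)) /\
         nth set0 a (size a).-1 = T) &
      (forall a t, Rs a -> (t.+1 < size a)%N ->
         transs (nth set0 a t) (G (take t.+1 a)) `<=`
         \bigcup_(C in succs A T Rs (take t.+1 a)) C)]].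

Definition trivial_reach_spanning Q T A G Rs : Prop :=
  [/\ A = [set Q `\` T],
      Rs = [set [:: T]] &
      exists u1 : U,
        (forall b, b != [::] -> (forall C, C \in b -> A C) -> G b = u1) /\
        forall xi : nat -> X,
          (Q `\` T) (xi 0%N) ->
          (forall t, trans S (xi t) u1 (xi t.+1)) ->
          exists n, T (xi n) /\
            (forall t, (t < n)%N -> (Q `\` T) (xi t))].

Definition reach_spanning Q T A G Rs : Prop :=
  regular_reach_spanning Q T A G Rs \/ trivial_reach_spanning Q T A G Rs.

Definition initials T Rs : set (set X) :=
  [set C | exists2 a, Rs a & C = nth set0 a 0%N /\ C <> T].

(* Only used on finite sets ([fset_set] is empty on infinite ones). *)
Definition log2_card {K : realType} (B : set (set X)) : K :=
  ln (#|` fset_set B|)%:R / ln 2.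

Definition seq_entropy {K : realType} T A Rs a : K :=
  if (1 < size a)%N then
    (\sum_(0 <= t < (size a - 2)%N)
        log2_card (succs A T Rs (take t.+1 a) `\ T)
     + log2_card (initials T Rs)) / (size a).-1%:R
  else 0.

(* The supremum of a nonempty finite set, that is, its maximum. *)
Definition set_entropy {K : realType} T A Rs : K :=
  sup [set seq_entropy T A Rs a | a in Rs].

(* The minimum is taken as an infimum, with value +oo when there is no
   reach-spanning set in (A, G). *)
Definition cover_entropy (K : realType) Q T A G : \bar K :=
  ereal_inf [set (set_entropy T A Rs)%:E | Rs in reach_spanning Q T A G].

Definition reachability_entropy (K : realType) Q T : \bar K :=
  if `[< reachability_satisfiable Q T >] then
    ereal_inf [set cover_entropy K Q T AG.1 AG.2 |
                AG in [set AG | finite_cover AG.1 (Q `\` T)]]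
  else +oo%E.

End ReachabilityEntropy.

Arguments reachability_entropy : clear implicits.

(* Main.v *)
(* As [#R(x1) = 1], the relation [R] is the graph of a map [f], and the
   hypotheses read [Q1 = f^-1(Q2)], [T1 = f^-1(T2)], [Q2] included in the range
   of [f].  Preimage by [f] is injective on subsets of the range, with left
   inverse the direct image, so it transports covers, strategies and
   reach-spanning sets of the second system to the first one, without changing
   any of the cardinalities that enter the entropy. *)
Require Import Defs.
From mathcomp Require Import all_boot all_order all_algebra.
From mathcomp Require Import all_classical all_reals.
From mathcomp Require Import ereal.

Set Implicit Arguments.
Unset Strict Implicit.
Unset Printing Implicit Defensive.

Import Order.TTheory.

Local Open Scope classical_set_scope.

(** * Preimages of subsets of the range of a map *)

Section PreimageRange.
Context {X1 X2 : Type} (f : X1 -> X2).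
Implicit Types (B C : set X2) (a b : seq (set X2)).

Lemma image_preimage_range B : B `<=` range f -> f @` (f @^-1` B) = B.
Proof.
move=> Bf; apply/seteqP; split; first exact: image_preimage_subset.
by move=> y By; have [x _ fx] := Bf y By; exists x => //; rewrite /preimage /= fx.
Qed.

Lemma preimage_range_inj B C : B `<=` range f -> C `<=` range f ->
  f @^-1` B = f @^-1` C -> B = C.
Proof.
by move=> Bf Cf /(congr1 (image^~ f)); rewrite !image_preimage_range.
Qed.

(** Under this condition a sequence can be recovered from the preimages of its entries. *)
Definition ranges_in a := {in a, forall B, B `<=` range f}.

Lemma ranges_in_nth a t : ranges_in a -> nth set0 a t `<=` range f.
Proof.
move=> af; have [lt_t|ge_t] := ltnP t (size a); first exact/af/mem_nth.
by rewrite nth_default.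
Qed.

Lemma ranges_in_take a n : ranges_in a -> ranges_in (take n a).
Proof. by move=> af B /mem_take; apply: af. Qed.

Lemma map_image_preimage a : ranges_in a ->
  [seq f @` D | D <- [seq f @^-1` B | B <- a]] = a.
Proof.
move=> af; rewrite -map_comp; apply: map_id_in => B /af.
exact: image_preimage_range.
Qed.

Lemma map_preimage_inj a b : ranges_in a -> ranges_in b ->
  [seq f @^-1` B | B <- a] = [seq f @^-1` B | B <- b] -> a = b.
Proof.
move=> af bf /(congr1 (map (image^~ f))).
by rewrite !map_image_preimage.
Qed.

(** No bound on [t] is required because the default [set0] is its own preimage. *)
Lemma nth_map_preimage a t :
  nth set0 [seq f @^-1` B | B <- a] t = f @^-1` nth set0 a t.
Proof.
have [lt_t|ge_t] := ltnP t (size a); first exact: nth_map.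
by rewrite !nth_default ?size_map// preimage_set0.
Qed.

End PreimageRange.

Lemma eq_log2_card (K : realType) (S1 S2 : system)
    (B : set (set (state S1))) (C : set (set (state S2))) :
  finite_set C -> (B #= C)%card -> log2_card B = log2_card C :> K.
Proof.
move=> /finite_setP[n Cn] BC; rewrite /log2_card.
by rewrite (card_fset_set Cn) (card_fset_set (card_eq_trans BC Cn)).
Qed.

(** * Invariance of the entropy under preimage *)

Section Transport.
Context {S1 S2 : system} (f : state S1 -> state S2).
Implicit Types (Q T : set (state S2)) (A : set (set (state S2))).
Implicit Types (G : seq (set (state S2)) -> input S2).
Implicit Types (Rs : set (seq (set (state S2)))) (a b : seq (set (state S2))).

Local Notation pre := (preimage f).

Lemma eq_log2_card_preimage (K : realType) A : finite_set A ->
  (forall B, A B -> B `<=` range f) ->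
  log2_card (pre @` A) = log2_card A :> K.
Proof.
move=> Afin Af; apply: eq_log2_card => //; apply: inj_card_eq => B C.
by rewrite !inE => /Af Bf /Af Cf; apply: preimage_range_inj.
Qed.

(** By injectivity on subsets of the range, [T] is the only candidate whose preimage is [pre T], so
    discarding the target commutes with transport. *)
Lemma image_preimageD1 A T : T `<=` range f ->
  (forall B, A B -> B `<=` range f) ->
  (pre @` A) `\ pre T = pre @` (A `\ T).
Proof.
move=> Tf Af; apply/seteqP; split=> [_ [[B AB <-] BT]|_ [B [AB BT] <-]].
  by exists B => //; split=> // BeT; apply: BT; rewrite BeT.
split; first by exists B.
by move=> /(preimage_range_inj (Af _ AB) Tf).
Qed.

(** Injectivity enters twice. On sequences, it ensures that transport creates no new coincidence of
    prefixes; on sets, it pulls membership in the cover, or equality with the target, back to the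
    second system. *)
Lemma succs_preimage A T Rs b : T `<=` range f ->
  (forall B, A B -> B `<=` range f) -> (forall a, Rs a -> ranges_in f a) ->
  ranges_in f b ->
  succs (pre @` A) (pre T) (map pre @` Rs) (map pre b) = pre @` succs A T Rs b.
Proof.
move=> Tf Af Rf bf; apply/seteqP; split.
  move=> C [AC [_ [a Ra <-] []]]; rewrite !size_map nth_map_preimage.
  rewrite -map_take => ltba tab eC; exists (nth set0 a (size b)) => //.
  split.
    have nf := ranges_in_nth (t := size b) (Rf _ Ra).
    rewrite eC in AC; case: AC => [[B AB]|].
      by move=> /(preimage_range_inj (Af _ AB) nf) <-; left.
    by move=> /(preimage_range_inj nf Tf); right.
  exists a => //; split=> //; apply: map_preimage_inj tab => //.
  exact/ranges_in_take/Rf.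
move=> _ [C [AC [a Ra [ltba tab eC]]] <-]; subst C; split.
  by case: AC => [AC|->]; [left; exists (nth set0 a (size b))|right].
exists (map pre a); first by exists a.
by rewrite !size_map -map_take tab nth_map_preimage.
Qed.

Lemma initials_preimage T Rs : T `<=` range f ->
  (forall a, Rs a -> ranges_in f a) ->
  initials (pre T) (map pre @` Rs) = pre @` initials T Rs.
Proof.
move=> Tf Rf; apply/seteqP; split.
  move=> _ [_ [a Ra <-] [-> aT]]; rewrite nth_map_preimage in aT *.
  exists (nth set0 a 0%N) => //; exists a => //; split=> // a0T.
  by apply: aT; rewrite a0T.
move=> _ [_ [a Ra [-> aT]] <-]; exists (map pre a); first by exists a.
rewrite nth_map_preimage; split=> //.
by move=> /(preimage_range_inj (ranges_in_nth (t := 0%N) (Rf _ Ra)) Tf).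
Qed.

Lemma seq_entropy_preimage (K : realType) A T Rs a : finite_set A ->
  T `<=` range f -> (forall B, A B -> B `<=` range f) ->
  finite_set Rs -> (forall a, Rs a -> ranges_in f a) -> Rs a ->
  seq_entropy (pre T) (pre @` A) (map pre @` Rs) (map pre a)
  = seq_entropy T A Rs a :> K.
Proof.
move=> Afin Tf Af Rfin Rf Ra; rewrite /seq_entropy size_map.
case: ifP => // _; congr ((_ + _) / _)%R; last first.
  rewrite initials_preimage//; apply: eq_log2_card_preimage.
    (* Initial sets are first entries of the finitely many sequences in [Rs]. *)
    apply: (sub_finite_set _ (finite_image (nth set0 ^~ 0%N) Rfin)).
    by move=> _ [b Rb [-> _]]; exists b.
  by move=> _ [b Rb [-> _]]; exact/ranges_in_nth/Rf.
apply: eq_bigr => t _; rewrite -map_take succs_preimage//; last first.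
  exact/ranges_in_take/Rf.
have succsf B : succs A T Rs (take t.+1 a) B -> B `<=` range f.
  by move=> [[/Af|->]].
rewrite image_preimageD1//; apply: eq_log2_card_preimage.
  by apply: (sub_finite_set _ Afin) => B [[[]]].
by move=> B [/succsf].
Qed.

Lemma set_entropy_preimage (K : realType) A T Rs : finite_set A ->
  T `<=` range f -> (forall B, A B -> B `<=` range f) ->
  finite_set Rs -> (forall a, Rs a -> ranges_in f a) ->
  set_entropy (pre T) (pre @` A) (map pre @` Rs) = set_entropy T A Rs :> K.
Proof.
move=> Afin Tf Af Rfin Rf; rewrite /set_entropy image_comp.
congr sup; apply: eq_imagel => a Ra /=; exact: seq_entropy_preimage.
Qed.

Lemma finite_cover_preimage A Q T : finite_cover A (Q `\` T) ->
  finite_cover (pre @` A) (pre Q `\` pre T).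
Proof.
move=> [Afin AQT]; split; first exact: finite_image.
by rewrite bigcup_image -[RHS]/(pre (Q `\` T)) -AQT preimage_bigcup.
Qed.

Lemma finite_cover_sub A B C : finite_cover A B -> A C -> C `<=` B.
Proof. by move=> [_ <-] AC x Cx; exists C. Qed.

(** Supplies what injectivity requires, in both cases: entries lie in [Q] for a regular set, and [T]
    is the only entry in the trivial one. *)
Lemma reach_spanning_ranges Q T A G Rs : Q `<=` range f -> T `<=` Q ->
  reach_spanning Q T A G Rs ->
  finite_set Rs /\ forall a, Rs a -> ranges_in f a.
Proof.
move=> Qf TQ [[Rfin _ Rs_Q _]|[_ -> _]]; split=> //.
  by move=> a /Rs_Q[_ aQ] B /(nthP set0)[t /aQ tQ <-] x /tQ /Qf.
by move=> _ -> B; rewrite inE => /eqP -> x /TQ /Qf.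
Qed.

(** * Transport of strategies and reach-spanning sets *)

Variable r : input S2 -> input S1.
(** The feedback refinement condition when the relation is the graph of [f]. *)
Hypothesis fr : forall x u y, trans S1 x (r u) y -> trans S2 (f x) u (f y).

(** The first system observes its history through [f] and applies [r] to the input chosen by [k].
    Each of its runs is then mapped by [f] to a run of the second system under [k], so staying in
    [Q] and reaching [T] pull back. *)
Lemma reachability_satisfiable_preimage Q T :
  reachability_satisfiable Q T -> reachability_satisfiable (pre Q) (pre T).
Proof.
move=> [V [Vfin [k kV satQ]]]; exists (r @` V); split; first exact: finite_image.
exists (fun s => r (k (map f s))); first by move=> s; exists (k (map f s)).
move=> step xi Qxi; have [fxiQ fxiT] := satQ (f \o xi) Qxi.
have step_f t : step xi t ->
    trans S2 (f (xi t)) (k (mkseq (f \o xi) t.+1)) (f (xi t.+1)).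
  by move=> /fr; rewrite /mkseq -map_comp.
split=> [n stepn|stepn].
  by apply: fxiQ => t /stepn[/step_f].
by apply: fxiT => t; apply: step_f.
Qed.

(** Direct images recover the cells of the second cover from their preimages, so on a transported
    sequence the input is [r] of the one that [G] chooses on the original. *)
Definition transported_strategy G (b : seq (set (state S1))) :=
  r (G [seq f @` B | B <- b]).

Lemma regular_reach_spanning_preimage Q T A G Rs : Q `<=` range f ->
  T `<=` Q -> finite_cover A (Q `\` T) ->
  regular_reach_spanning Q T A G Rs ->
  regular_reach_spanning (pre Q) (pre T) (pre @` A) (transported_strategy G)
    (map pre @` Rs).
Proof.
move=> Qf TQ covA spanR.
have [Rfin Rf] := reach_spanning_ranges Qf TQ (or_introl spanR).
have [_ [a0 Ra0] Rs_Q [QE AT Rs_trans]] := spanR.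
have Af B : A B -> B `<=` range f.
  by move=> AB; apply: subset_trans (finite_cover_sub covA AB) _ => x [/Qf].
split.
- exact: finite_image.
- by exists (map pre a0), a0.
- move=> _ [a Ra <-]; rewrite size_map; have [a_gt0 aQ] := Rs_Q a Ra.
  by split=> // t /aQ tQ; rewrite nth_map_preimage; apply: preimage_subset.
split.
- rewrite bigcup_image QE preimage_bigcup.
  by apply: eq_bigcupr => a _; rewrite nth_map_preimage.
- move=> _ [a Ra <-]; rewrite size_map nth_map_preimage.
  have [aA aT] := AT a Ra; split=> [t /aA At|]; last by rewrite aT.
  by rewrite nth_map_preimage; exists (nth set0 a t).
- move=> _ t [a Ra <-]; rewrite size_map nth_map_preimage -map_take => lt_t.
  have taf := ranges_in_take (n := t.+1) (Rf a Ra).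
  rewrite succs_preimage// ?bigcup_image; last by move=> x /TQ /Qf.
  (* A transition from [x] to [y] is sent by [f] to one of the second system, where a successor cell
     [C] contains [f y]; hence [y] lies in the preimage of [C]. *)
  rewrite /transported_strategy map_image_preimage// => y [x ax /fr fy].
  have [|C sC Cy] := Rs_trans a t Ra lt_t (f y); first by exists (f x).
  by exists C.
Qed.

Lemma trivial_reach_spanning_preimage Q T A G Rs : Q `<=` range f ->
  trivial_reach_spanning Q T A G Rs ->
  trivial_reach_spanning (pre Q) (pre T) (pre @` A) (transported_strategy G)
    (map pre @` Rs).
Proof.
move=> Qf [-> -> [u1 [Gu1 trajT]]]; split; [exact: image_set1..|].
exists (r u1); split=> [b b0 bQT|xi QTxi xi_step].
  (* Every entry of [b] is the preimage of the single cell of the trivial cover, and its direct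
     image is that cell again. *)
  congr r; apply: Gu1; first by case: b b0 {bQT}.
  move=> _ /mapP[_ /bQT[B -> <-] ->].
  rewrite image_preimage_range//.
  by move=> x [/Qf].
by apply: (trajT (f \o xi)) => // t; apply/fr/xi_step.
Qed.

(** Every reach-spanning set of the second system yields one of equal entropy for the first, so the
    infimum on the left ranges over at least the same values. *)
Lemma cover_entropy_preimage (K : realType) Q T A G : Q `<=` range f ->
  T `<=` Q -> finite_cover A (Q `\` T) ->
  (cover_entropy K (pre Q) (pre T) (pre @` A) (transported_strategy G)
   <= cover_entropy K Q T A G)%E.
Proof.
move=> Qf TQ covA; apply: le_ereal_inf_tmp => _ [Rs spanR <-].
have Tf : T `<=` range f by move=> x /TQ /Qf.
have Af B : A B -> B `<=` range f.
  by move=> AB; apply: subset_trans (finite_cover_sub covA AB) _ => x [/Qf].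
have [Rfin Rf] := reach_spanning_ranges Qf TQ spanR.
apply: ereal_inf_lbound; exists (map pre @` Rs); last first.
  by rewrite (set_entropy_preimage _ covA.1).
case: spanR => spanR; [left|right].
- exact: regular_reach_spanning_preimage.
- exact: trivial_reach_spanning_preimage.
Qed.

Lemma reachability_entropy_preimage (K : realType) Q T : Q `<=` range f ->
  T `<=` Q ->
  (reachability_entropy S1 K (pre Q) (pre T) <= reachability_entropy S2 K Q T)%E.
Proof.
move=> Qf TQ; rewrite /reachability_entropy.
case: (asboolP (reachability_satisfiable Q T)) => [sat2|_]; last exact: leey.
rewrite (asboolT (reachability_satisfiable_preimage sat2)).
apply: le_ereal_inf_tmp => _ [[A G] /= covA <-].
apply: le_trans (cover_entropy_preimage K G Qf TQ covA).
apply: ereal_inf_lbound; exists (pre @` A, transported_strategy G) => //=.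
exact: finite_cover_preimage.
Qed.

End Transport.

(** * From the relation to a map *)

Lemma card_eq1_singleton (X : Type) (B : set X) :
  (B #= `I_1)%card -> exists x, B = [set x].
Proof.
move=> /card_set_bijP[g [gB ginj /(_ 0%N isT)[x Bx _]]]; exists x.
apply/seteqP; split=> [y By|_ -> //]; apply: ginj; rewrite ?inE//.
by have := gB _ By; have := gB _ Bx; rewrite /= !ltnS !leqn0 => /eqP -> /eqP ->.
Qed.

Lemma functional_rel_graph (X1 X2 : Type) (R : set (X1 * X2)) :
  (forall x1, (xsection R x1 #= `I_1)%card) ->
  exists f : X1 -> X2, forall x1 x2, R (x1, x2) <-> x2 = f x1.
Proof.
move=> R1; have [f Rf] := choice (fun x1 => card_eq1_singleton (R1 x1)).
exists f => x1 x2; have := Rf x1 => /seteqP[sub sup]; split.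
  by move=> Rx; apply: sub; apply/xsectionP.
by move=> ->; apply/xsectionP; apply: sup.
Qed.

Theorem theorem2 (K : realType) (S1 S2 : system)
    (Q1 T1 : set (state S1)) (Q2 T2 : set (state S2))
    (R : set (state S1 * state S2)) :
  T1 `<=` Q1 -> T1 !=set0 -> Q1 !=set0 ->
  T2 `<=` Q2 -> T2 !=set0 -> Q2 !=set0 ->
  feedback_refinement_relation R ->
  Q1 = relpreimg R Q2 ->
  T1 = relpreimg R T2 ->
  (forall x1, (xsection R x1 #= `I_1)%card) ->
  (forall x2, Q2 x2 -> ysection R x2 !=set0) ->
  (reachability_entropy S1 K Q1 T1 <= reachability_entropy S2 K Q2 T2)%E.
Proof.
move=> _ _ _ TQ2 _ _ [_ [r rR]] -> -> /functional_rel_graph[f Rf] R_onto.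
have preE D : relpreimg R D = f @^-1` D.
  apply/seteqP; split=> [x1 [x2 Dx2 /ysectionP/Rf x2E]|x1 Dx1].
    by rewrite /preimage /= -x2E.
  by exists (f x1) => //; apply/ysectionP/Rf.
rewrite !preE; apply: (reachability_entropy_preimage (r := r)) => //.
  (* Refinement is applied to the related pair of [x] and [f x]; since [y] is related to [f y], the
     latter lies in the image of the transitions from [x]. *)
  move=> x u y xy; apply: (rR x (f x) u); first exact/Rf.
  by exists y => //; apply/xsectionP/Rf.
(* Nonempty fibres over [Q2] place it in the range of [f]. *)
by move=> x2 /R_onto[x1 /ysectionP/Rf ->]; exists x1.
Qed.
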